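(* Let $(S,\mathfrak{F},\tau)$ be a probabilistic metric space with $\tau$ continuous, let $I$ be a strongly admissible ideal of $\mathbb{N}\times\mathbb{N}$, and let $x=(x_{jk})_{j,k\in\mathbb{N}}$ be a strong $I^*$-statistically pre-Cauchy double sequence in $S$. Then $x$ is strong $I$-statistically pre-Cauchy.
   Context: Ideals. An ideal on a set $X$ is a class $I\subseteq 2^X$ with $\emptyset\in I$, closed under finite unions and under taking subsets; it is non-trivial if $X\notin I$. For a non-trivial ideal $I$ on $X$, $\mathbb{F}(I)=\{X\setminus A: A\in I\}$ is the filter associated with $I$. A non-trivial ideal $I$ of $\mathbb{N}\times\mathbb{N}$ is strongly admissible if $\{i\}\times\mathbb{N}\in I$ and $\mathbb{N}\times\{i\}\in I$ for each $i\in\mathbb{N}$. Probabilistic metric spaces. $\Delta^+$ is the set of non-decreasing functions $G:[0,\infty]\to[0,1]$ with $G(0)=0$, $G(\infty)=1$, left continuous on $(0,\infty)$ (extended by $G(x)=0$ for $x<0$), ordered pointwise. $\epsilon_0\in\Delta^+$ is given by $\epsilon_0(x)=0$ for $x\le 0$ and $\epsilon_0(x)=1$ for $x>0$. For $F,G\in\Delta^+$, $d_L(F,G)$ is the infimum of all $h\in(0,1]$ such that $F(x-h)-h\le G(x)\le F(x+h)+h$ and $G(x-h)-h\le F(x)\le G(x+h)+h$ for every $x\in(-1/h,1/h)$; $d_L$ is a metric on $\Delta^+$. A triangle function is a binary operation $\tau:\Delta^+\times\Delta^+\to\Delta^+$ that is commutative, associative, non-decreasing in each place, and has $\epsilon_0$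 as identity; continuity of $\tau$ is with respect to $d_L$. A probabilistic metric (PM) space is a triple $(S,\mathfrak{F},\tau)$ with $S$ a nonempty set, $\tau$ a triangle function, and $\mathfrak{F}:S\times S\to\Delta^+$, $\mathfrak{F}(x,y)=F_{xy}$, such that for all $x,y,z\in S$: $F_{xx}=\epsilon_0$; $F_{xy}\ne\epsilon_0$ if $x\ne y$; $F_{xy}=F_{yx}$; $F_{xz}\ge\tau(F_{xy},F_{yz})$. For $t>0$ put $\mathfrak{U}(t)=\{(x,y)\in S\times S: F_{xy}(t)>1-t\}$. A double sequence $(x_{jk})$ in $S$ is strong $I$-statistically pre-Cauchy if for all $t>0$ and $\delta>0$, $$\left\{(m,n)\in\mathbb{N}\times\mathbb{N}:\tfrac{1}{m^2n^2}\left|\{(j,k,p,q): (x_{jk},x_{pq})\notin\mathfrak{U}(t),\ j,p\le m,\ k,q\le n\}\right|\ge\delta\right\}\in I.$$ It is strong $I^*$-statistically pre-Cauchy if there exists $M\in\mathbb{F}(I)$ such that for every $t>0$ $$\lim_{\substack{m,n\to\infty\\(m,n)\in M}}\tfrac{1}{m^2n^2}\left|\{(j,k,p,q): d_L(F_{x_{jk}x_{pq}},\epsilon_0)\ge t,\ j,p\le m,\ k,q\le n\}\right|=0,$$ i.e. for every $\epsilon>0$ there is $n_0$ such that the expression is $<\epsilon$ for all $(m,n)\in M$ with $m,n\ge n_0$. *)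

(* Defs.v *)
From HB Require Import structures.
From mathcomp Require Import all_boot all_order all_algebra.
From mathcomp Require Import finmap.
From mathcomp Require Import all_classical all_reals all_analysis.

Set Implicit Arguments.
Unset Strict Implicit.
Unset Printing Implicit Defensive.

Import Order.TTheory GRing.Theory Num.Theory.
Import numFieldNormedType.Exports.

Local Open Scope classical_set_scope.
Local Open Scope ring_scope.

(* Indices start at 1, so that 1 / (m^2 n^2) always makes sense. *)
Definition natpos := {n : nat | (0 < n)%N}.

Section Ideals.

Record is_ideal (X : Type) (I : set (set X)) : Prop := IsIdeal {
  ideal0 : I set0;
  idealU : forall A B, I A -> I B -> I (A `|` B);
  idealS : forall A B, A `<=` B -> I B -> I A }.

Definition nontrivial_ideal (X : Type) (I : set (set X)) : Prop :=
  is_ideal I /\ ~ I [set: X].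

Definition ideal_filter (X : Type) (I : set (set X)) : set (set X) :=
  [set ~` A | A in I].

Definition strongly_admissible (I : set (set (natpos * natpos))) : Prop :=
  nontrivial_ideal I /\
  forall i : natpos, I ([set i] `*` setT) /\ I (setT `*` [set i]).

End Ideals.

Section DistanceDistributionFunctions.
Variable R : realType.

(* A function on [0, +oo] is represented by its extension by 0 to \bar R. *)
Record Delta_plus := DeltaPlus {
  Dfun :> \bar R -> R;
  Dfun_range : forall x, 0 <= Dfun x <= 1;
  Dfun_homo : {homo Dfun : x y / (x <= y)%E >-> x <= y};
  Dfun_le0 : forall x, (x <= 0)%E -> Dfun x = 0;
  Dfun_pinfty : Dfun +oo%E = 1;
  Dfun_left_continuous : forall x : R, 0 < x ->
    Dfun y%:E @[y --> x^'-] --> Dfun x%:E }.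

Definition Dle (F G : Delta_plus) : Prop := forall x : \bar R, F x <= G x.

Definition eps0_fun (x : \bar R) : R := if (x <= 0)%E then 0 else 1.

Lemma eps0_range x : 0 <= eps0_fun x <= 1.
Proof. by rewrite /eps0_fun; case: ifP => _; rewrite ?lexx ?ler01. Qed.

Lemma eps0_homo : {homo eps0_fun : x y / (x <= y)%E >-> x <= y}.
Proof.
move=> x y xy; rewrite /eps0_fun; case: (leP y 0%E) => y0.
  by rewrite (le_trans xy y0).
by case: ifP => _; rewrite ?lexx ?ler01.
Qed.

Lemma eps0_le0 x : (x <= 0)%E -> eps0_fun x = 0.
Proof. by rewrite /eps0_fun => ->. Qed.

Lemma eps0_pinfty : eps0_fun +oo%E = 1.
Proof. by []. Qed.

Lemma eps0_left_continuous (x : R) : 0 < x ->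
  eps0_fun y%:E @[y --> x^'-] --> eps0_fun x%:E.
Proof.
move=> x0; have -> : eps0_fun x%:E = 1 by rewrite /eps0_fun lee_fin leNgt x0.
apply: cvg_near_cst; near=> y.
have y0 : 0 < y by near: y; exact: nbhs_left_gt.
by rewrite /eps0_fun lee_fin leNgt y0.
Unshelve. all: by end_near. Qed.

Definition eps0 : Delta_plus :=
  DeltaPlus eps0_range eps0_homo eps0_le0 eps0_pinfty eps0_left_continuous.

Definition dL (F G : Delta_plus) : R :=
  inf [set h : R | 0 < h <= 1 /\
    forall x : R, - (1 / h) < x < 1 / h ->
      (F (x - h)%:E - h <= G x%:E <= F (x + h)%:E + h) /\
      (G (x - h)%:E - h <= F x%:E <= G (x + h)%:E + h)].

Record is_triangle_function (tau : Delta_plus -> Delta_plus -> Delta_plus) :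
    Prop := IsTriangleFunction {
  triangleC : commutative tau;
  triangleA : associative tau;
  triangle_homol : forall F F' G, Dle F F' -> Dle (tau F G) (tau F' G);
  triangle_homor : forall F G G', Dle G G' -> Dle (tau F G) (tau F G');
  triangle_eps0l : left_id eps0 tau;
  triangle_eps0r : right_id eps0 tau }.

Definition dL_continuous (tau : Delta_plus -> Delta_plus -> Delta_plus) : Prop :=
  forall (F G : Delta_plus) (e : R), 0 < e -> exists2 d : R, 0 < d &
    forall F' G' : Delta_plus, dL F F' < d -> dL G G' < d ->
      dL (tau F G) (tau F' G') < e.

Record is_PM_space (S : Type) (F : S -> S -> Delta_plus)
    (tau : Delta_plus -> Delta_plus -> Delta_plus) : Prop := IsPMSpace {
  PM_nonempty : [set: S] !=set0;
  PM_triangle_function : is_triangle_function tau;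
  PM_refl : forall x, F x x = eps0;
  PM_sep : forall x y, x <> y -> F x y <> eps0;
  PM_sym : forall x y, F x y = F y x;
  PM_triangle : forall x y z, Dle (tau (F x y) (F y z)) (F x z) }.

End DistanceDistributionFunctions.

Arguments eps0 {R}.

Section PreCauchy.
Variables (R : realType) (S : Type) (F : S -> S -> Delta_plus R).
Implicit Type x : natpos -> natpos -> S.

Definition strong_vicinity (t : R) : set (S * S) :=
  [set u | F u.1 u.2 t%:E > 1 - t].

Definition index_set x (A : set (S * S)) (m n : natpos) :
    set (natpos * natpos * natpos * natpos) :=
  [set i | let: (j, k, p, q) := i in
    [/\ A (x j k, x p q), (val j <= val m)%N, (val p <= val m)%N,
        (val k <= val n)%N & (val q <= val n)%N]].

(* fset_set returns the empty set on infinite sets; this never happens here. *)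
Lemma finite_index_set x A m n : finite_set (index_set x A m n).
Proof.
have fin (b : natpos) : finite_set [set j : natpos | (val j <= val b)%N].
  apply: (@sub_finite_set _ _ (val @^-1` `I_(val b).+1)) => [j|] //=.
  by apply: finite_preimage (finite_II _) => i j _ _; exact: val_inj.
have := finite_setX (finite_setX (finite_setX (fin m) (fin n)) (fin m)) (fin n).
by apply: sub_finite_set => -[[[j k] p] q] [].
Qed.

Definition pair_density x (A : set (S * S)) (m n : natpos) : R :=
  1 / ((val m)%:R ^+ 2 * (val n)%:R ^+ 2) *
  #|` fset_set (index_set x A m n)|%fset%:R.

Definition strong_I_stat_preCauchy (I : set (set (natpos * natpos))) x : Prop :=
  forall t d : R, 0 < t -> 0 < d ->
    I [set mn | pair_density x (~` strong_vicinity t) mn.1 mn.2 >= d].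

Definition strong_Istar_stat_preCauchy (I : set (set (natpos * natpos))) x : Prop :=
  exists2 M, ideal_filter I M &
    forall t : R, 0 < t ->
    forall e : R, 0 < e -> exists n0 : natpos, forall m n : natpos,
      M (m, n) -> (val n0 <= val m)%N -> (val n0 <= val n)%N ->
      pair_density x [set u | dL (F u.1 u.2) eps0 >= t] m n < e.

End PreCauchy.

(* Main.v *)
(* If d_L(F, eps_0) < t, some admissible h < t witnesses F > 1 - t at a point
   below t, so the complement of the vicinity U(t) lies in {d_L >= t} and its
   density is the smaller one. Hence {density >= d} is covered by the
   complement of M together with finitely many rows and columns. *)
Require Import Defs.
From HB Require Import structures.
From mathcomp Require Import all_boot all_order all_algebra.
From mathcomp Require Import all_classical all_reals all_analysis.
From mathcomp Require Import finmap lra.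

Set Implicit Arguments.
Unset Strict Implicit.
Unset Printing Implicit Defensive.

Import Order.TTheory GRing.Theory Num.Theory.

Local Open Scope classical_set_scope.
Local Open Scope ring_scope.

Lemma Dfun_ge0 (R : realType) (G : Delta_plus R) y : 0 <= G y.
Proof. by have /andP[] := Dfun_range G y. Qed.

Lemma Dfun_le1 (R : realType) (G : Delta_plus R) y : G y <= 1.
Proof. by have /andP[] := Dfun_range G y. Qed.

(** An infimum below [t] has a member of its set below [t], provided that the set is nonempty. *)
Lemma dL_lt_witness (R : realType) (F G : Delta_plus R) (t : R) :
  dL F G < t -> exists2 h : R, 0 < h <= 1 /\ h < t &
    forall x : R, - (1 / h) < x < 1 / h ->
      (F (x - h)%:E - h <= G x%:E <= F (x + h)%:E + h) /\
      (G (x - h)%:E - h <= F x%:E <= G (x + h)%:E + h).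
Proof.
move=> dLt; have [|h [h01 hFG] ht] := inf_lt _ dLt; last by exists h.
(* All values lie in [0,1], so a slack of 1 makes every inequality trivial. *)
exists 1; split=> [|x _]; first by rewrite ltr01 lexx.
have F0 := Dfun_ge0 F; have F1 := Dfun_le1 F.
have G0 := Dfun_ge0 G; have G1 := Dfun_le1 G.
have := (F1 (x - 1)%:E, F0 (x + 1)%:E, F0 x%:E, F1 x%:E).
have := (G1 (x - 1)%:E, G0 (x + 1)%:E, G0 x%:E, G1 x%:E).
by move=> [[[? ?] ?] ?] [[[? ?] ?] ?]; split; apply/andP; split; lra.
Qed.

Lemma dL_eps0_lt (R : realType) (G : Delta_plus R) (t : R) :
  0 < t -> dL G eps0 < t -> 1 - t < G t%:E.
Proof.
move=> t0 /dL_lt_witness[h [/andP[h0 h1] ht] hG].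
have [t1|t1] := ltP 1 t; first by have := Dfun_ge0 G t%:E; lra.
(* The bound [h < y] gives [eps0] the value 1 at [y - h], and [y < t <= 1 <= 1 / h] keeps [y] in the
   admissible window. Hence [G y >= 1 - h > 1 - t]. *)
pose y := (h + t) / 2.
have yt : y < t by rewrite /y; lra.
have hy : h < y by rewrite /y; lra.
have h1V : 1 <= 1 / h by rewrite ler_pdivlMr // mul1r.
have [|_ /andP[+ _]] := hG y; first by apply/andP; split; lra.
rewrite /= /eps0_fun lee_fin subr_le0 [y <= h]leNgt hy /= => Gy.
have : G y%:E <= G t%:E by apply: Dfun_homo; rewrite lee_fin ltW.
lra.
Qed.

Lemma pair_density_le (R : realType) (S : Type) (x : natpos -> natpos -> S)
    (A B : set (S * S)) (m n : natpos) :
  A `<=` B -> pair_density R x A m n <= pair_density R x B m n.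
Proof.
move=> AB; rewrite /pair_density ler_wpM2l //.
rewrite ler_nat; apply: fsubset_leq_card.
(* Finiteness is essential: [fset_set] reflects inclusion only between finite sets. *)
rewrite -fset_set_sub; [|exact: finite_index_set..].
by move=> [[[j k] p] q] [/AB].
Qed.

(** By induction, raising the bound from [k.+1] to [k.+2] adds only the row and the column of index
    [k.+1], both in [I]. *)
Lemma strongly_admissible_strips (I : set (set (natpos * natpos))) (k : nat) :
  strongly_admissible I ->
  I [set mn | (val mn.1 < k)%N \/ (val mn.2 < k)%N].
Proof.
move=> [[[I0 IU IS] _] Iline]; elim: k => [|[|k] IHk].
- by apply: IS I0 => -[m n] [].
(* Indices start at 1, so the strips below 1 are still empty. *)
- by apply: IS IHk => -[[m m0] [n n0]] /= []; rewrite ltnS leqNgt ?m0 ?n0.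
pose i : natpos := exist _ k.+1 (ltn0Sn k).
have [Irow Icol] := Iline i.
apply: IS (IU _ _ IHk (IU _ _ Irow Icol)) => -[m n] /= [].
- rewrite ltnS leq_eqVlt => /orP[/eqP mk|mk]; last by left; left.
  by right; left; split=> //; exact: val_inj.
- rewrite ltnS leq_eqVlt => /orP[/eqP nk|nk]; last by left; right.
  by right; right; split=> //; exact: val_inj.
Qed.

Theorem theorem3p4 (R : realType) (S : Type) (F : S -> S -> Delta_plus R)
    (tau : Delta_plus R -> Delta_plus R -> Delta_plus R)
    (I : set (set (natpos * natpos))) (x : natpos -> natpos -> S)
    (PM : is_PM_space F tau) (tau_continuous : dL_continuous tau)
    (I_adm : strongly_admissible I)
    (x_preCauchy : strong_Istar_stat_preCauchy F I x) :
  strong_I_stat_preCauchy F I x.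
Proof.
move=> t d t0 d0; have [_ [A IA <-] /(_ t t0 d d0)[n0 dens_lt]] := x_preCauchy.
have [[[_ IU IS] _] _] := I_adm.
apply: IS (IU _ _ IA (strongly_admissible_strips (val n0) I_adm)).
move=> [m n] /= dens_ge; have [|nA] := pselect (A (m, n)); first by left.
right; have [|m_ge] := ltnP (val m) (val n0); first by left.
right; rewrite ltnNge; apply/negP => n_ge.
have := dens_lt m n nA m_ge n_ge; rewrite ltNge => /negP; apply.
apply: le_trans dens_ge _; apply: pair_density_le => -[y z] /= yzU.
by rewrite leNgt; apply/negP => /(dL_eps0_lt t0).
Qed.
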